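(* Let $\alpha\in(-1,0)\cup(0,+\infty)$ and let $\psi$ be an analytic function in $\mathbb{D}$ with $\psi(\mathbb{D})\subseteq\mathbb{D}$. Then $f\circ\psi$ is $\alpha$-harmonic in $\mathbb{D}$ for every $\alpha$-harmonic function $f$ in $\mathbb{D}$ if and only if there is $t\in[0,2\pi]$ such that $\psi(z)=e^{it}z$ for all $z\in\mathbb{D}$.
   Context: $\mathbb{D}=\{z\in\mathbb{C}:|z|<1\}$. With $\partial_z=\frac12(\partial_x-i\partial_y)$ and $\overline{\partial}_z=\frac12(\partial_x+i\partial_y)$, a complex-valued function $f\in\mathcal{C}^2(\mathbb{D})$ (twice continuously differentiable) is called $\alpha$-harmonic in $\mathbb{D}$ (where $\alpha>-1$) if $$\Delta_{\alpha}(f)(z)=\partial_z\big[(1-|z|^2)^{-\alpha}\,\overline{\partial}_z f\big](z)=0\quad\text{for all } z\in\mathbb{D}.$$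
   Formalization: The function ψ is additionally assumed nonconstant on the disk: for constant ψ the stated equivalence fails, since f∘ψ is then constant and hence α-harmonic for every f, while ψ is not a rotation. *)

(* Defs.v *)
From Stdlib Require Export Reals.
From Coquelicot Require Export Coquelicot.

Open Scope R_scope.

Definition unit_disk (z : C) : Prop := Cmod z < 1.

Definition ex_dx (f : C -> C) (z : C) : Prop :=
  ex_derive (fun t : R => Re (f (t, Im z))) (Re z) /\
  ex_derive (fun t : R => Im (f (t, Im z))) (Re z).

Definition ex_dy (f : C -> C) (z : C) : Prop :=
  ex_derive (fun t : R => Re (f (Re z, t))) (Im z) /\
  ex_derive (fun t : R => Im (f (Re z, t))) (Im z).

(* [Derive] is total with junk values, so [dx], [dy] (and the operators built
   from them) are meaningful only where [ex_dx], [ex_dy] hold. *)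
Definition dx (f : C -> C) (z : C) : C :=
  (Derive (fun t : R => Re (f (t, Im z))) (Re z),
   Derive (fun t : R => Im (f (t, Im z))) (Re z)).

Definition dy (f : C -> C) (z : C) : C :=
  (Derive (fun t : R => Re (f (Re z, t))) (Im z),
   Derive (fun t : R => Im (f (Re z, t))) (Im z)).

(* On an open set, continuous partial derivatives of f already make f
   continuous there. *)
Definition C1_on (U : C -> Prop) (f : C -> C) : Prop :=
  forall z : C, U z ->
    ex_dx f z /\ ex_dy f z /\ continuous (dx f) z /\ continuous (dy f) z.

Definition C2_on (U : C -> Prop) (f : C -> C) : Prop :=
  C1_on U f /\ C1_on U (dx f) /\ C1_on U (dy f).

Definition d_z (f : C -> C) (z : C) : C :=
  (RtoC (/ 2) * (dx f z - Ci * dy f z))%C.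

Definition d_zbar (f : C -> C) (z : C) : C :=
  (RtoC (/ 2) * (dx f z + Ci * dy f z))%C.

(* The base 1 - |z|^2 of [Rpower] is positive on the unit disk. *)
Definition Delta_alpha (alpha : R) (f : C -> C) (z : C) : C :=
  d_z (fun w : C =>
         (RtoC (Rpower (1 - Cmod w ^ 2) (- alpha)) * d_zbar f w)%C) z.

Definition alpha_harmonic (alpha : R) (f : C -> C) : Prop :=
  C2_on unit_disk f /\
  (forall z : C, unit_disk z -> Delta_alpha alpha f z = RtoC 0).

(* Complex differentiability: the scalar field of the derivative is C. *)
Definition analytic_on (U : C -> Prop) (f : C -> C) : Prop :=
  forall z : C, U z -> @ex_derive C_AbsRing C_NormedModule f z.

(* Constant self-maps psi of the disk have to be excluded from the theorem:
   f o psi is then constant, hence alpha-harmonic, for every f. *)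
Definition constant_on (U : C -> Prop) (f : C -> C) : Prop :=
  exists c : C, forall z : C, U z -> f z = c.

(* e^{it} *)
Definition cis (t : R) : C := (cos t, sin t).

(* Main.v *)
From Stdlib Require Import Lra Classical.
Require Import Defs.

(**
Write |f| for the modulus, f* for the conjugate, p and q for the two Wirtinger
derivatives of a function.

If f is alpha-harmonic, then f o psi has antiholomorphic Wirtinger derivative
q(f)(psi) times psi'*, so testing f o psi compares the weights
(1 - |z|^2)^alpha and (1 - |psi|^2)^alpha.  Two test functions extract all the
information.

The identity is alpha-harmonic, so psi itself is twice continuously
differentiable.  This replaces the regularity theory of holomorphic functions:
by symmetry of second derivatives psi' is again holomorphic
([holomorphic_derivative]).

The second test function f0(z) = z* F(|z|^2), with
F(s) the integral over u in [0,1] of (1 - s u)^alpha, solves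
q(f0) = (1 - |z|^2)^alpha ([alpha_harmonic_test_function]).  The
alpha-harmonicity of f0 o psi says that
((1 - |psi|^2) / (1 - |z|^2))^alpha psi'* is antiholomorphic.  As alpha <> 0, at
the points where psi' does not vanish this amounts to
<<
  (E)   z* (1 - |psi|^2) = psi* psi' (1 - |z|^2)
>>
([conformal_factor_equation]).  Applying d/dzbar to (E) and comparing with (E)
and its conjugate forces |psi(z)| = |z| and |psi'(z)| = 1
([conformal_factor_rigidity], [derivative_unimodular]).  So |psi'| only takes
the values 0 and 1; by connectedness of the disk and since psi is not constant,
|psi'| = 1 everywhere ([derivative_nowhere_zero]).  Then (E) reduces to
psi(z) = z psi'(z); differentiating this once more gives z psi''(z) = 0, hence
psi' is a constant of modulus 1 ([composition_forces_rotation]).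

Conversely, a rotation preserves |z| and multiplies the two Wirtinger
derivatives by a and a*, so it commutes with the operator up to the factor
a a* = 1 ([rotation_preserves]).

All derivatives are handled through [wirtinger_at], a form of real
differentiability for which the rules of calculus reduce to continuity of
algebraic expressions.
*)

(** * Continuity of complex-valued functions *)

Lemma continuous_pair (U : UniformSpace) (f : U -> C) (x : U) :
  continuous (fun u => Re (f u)) x -> continuous (fun u => Im (f u)) x ->
  continuous f x.
Proof.
  intros H1 H2.
  apply (continuous_ext (fun u => (Re (f u), Im (f u)))).
  { intros u; now destruct (f u). }
  apply (continuous_comp_2 (fun u => Re (f u)) (fun u => Im (f u)) (fun a b : R => (a, b)) x H1 H2).
  apply (continuous_ext (fun y => y)). { now intros [a b]. } apply continuous_id.
Qed.

Lemma continuous_Re (U : UniformSpace) (f : U -> C) (x : U) :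
  continuous f x -> continuous (fun u => Re (f u)) x.
Proof.
  intros H. apply (continuous_comp f (fun c : C => Re c)); [exact H|].
  destruct (f x) as [a b]. apply (continuous_fst a b).
Qed.

Lemma continuous_Im (U : UniformSpace) (f : U -> C) (x : U) :
  continuous f x -> continuous (fun u => Im (f u)) x.
Proof.
  intros H. apply (continuous_comp f (fun c : C => Im c)); [exact H|].
  destruct (f x) as [a b]. apply (continuous_snd a b).
Qed.

Lemma continuous_Cplus (U : UniformSpace) (f g : U -> C) (x : U) :
  continuous f x -> continuous g x -> continuous (fun u => (f u + g u)%C) x.
Proof.
  intros Hf Hg. apply continuous_pair; simpl.
  - apply (continuous_plus (fun u => Re (f u)) (fun u => Re (g u))); now apply continuous_Re.
  - apply (continuous_plus (fun u => Im (f u)) (fun u => Im (g u))); now apply continuous_Im.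
Qed.

Lemma continuous_Copp (U : UniformSpace) (f : U -> C) (x : U) :
  continuous f x -> continuous (fun u => (- f u)%C) x.
Proof.
  intros Hf. apply continuous_pair; simpl.
  - apply (continuous_opp (fun u => Re (f u))); now apply continuous_Re.
  - apply (continuous_opp (fun u => Im (f u))); now apply continuous_Im.
Qed.

Lemma continuous_Cminus (U : UniformSpace) (f g : U -> C) (x : U) :
  continuous f x -> continuous g x -> continuous (fun u => (f u - g u)%C) x.
Proof.
  intros Hf Hg. apply continuous_Cplus; [exact Hf|]. now apply continuous_Copp.
Qed.

Lemma continuous_Cmult (U : UniformSpace) (f g : U -> C) (x : U) :
  continuous f x -> continuous g x -> continuous (fun u => (f u * g u)%C) x.
Proof.
  intros Hf Hg.
  pose proof (continuous_Re _ _ _ Hf) as H1. pose proof (continuous_Im _ _ _ Hf) as H2.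
  pose proof (continuous_Re _ _ _ Hg) as H3. pose proof (continuous_Im _ _ _ Hg) as H4.
  apply continuous_pair; simpl.
  - exact (continuous_minus _ _ _ (continuous_mult _ _ _ H1 H3) (continuous_mult _ _ _ H2 H4)).
  - exact (continuous_plus _ _ _ (continuous_mult _ _ _ H1 H4) (continuous_mult _ _ _ H2 H3)).
Qed.

Lemma continuous_Cconj (U : UniformSpace) (f : U -> C) (x : U) :
  continuous f x -> continuous (fun u => Cconj (f u)) x.
Proof.
  intros Hf. apply continuous_pair; simpl.
  - now apply continuous_Re.
  - apply (continuous_opp (fun u => Im (f u))); now apply continuous_Im.
Qed.

Lemma continuous_RtoC (U : UniformSpace) (f : U -> R) (x : U) :
  continuous f x -> continuous (fun u => RtoC (f u)) x.
Proof.
  intros Hf. apply continuous_pair; simpl; [exact Hf | apply continuous_const].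
Qed.

Lemma continuous_Cmod (U : UniformSpace) (f : U -> C) (x : U) :
  continuous f x -> continuous (fun u => Cmod (f u)) x.
Proof.
  intros Hf. apply (continuous_comp f Cmod x Hf).
  apply continuous_ext with (fun z : C => @norm R_AbsRing C_R_NormedModule z).
  { intros z; symmetry; apply Cmod_norm. }
  apply (filterlim_norm (K := R_AbsRing) (V := C_R_NormedModule)).
Qed.

(** * Moduli and the unit disk *)

Lemma RtoC_Cmod_sqr (z : C) : RtoC (Cmod z ^ 2) = (z * Cconj z)%C.
Proof. apply Cmod2_conj. Qed.

Lemma Cmod_sqr_lt_1 (z : C) : unit_disk z -> Cmod z ^ 2 < 1.
Proof. unfold unit_disk. intros H. pose proof (Cmod_ge_0 z). nra. Qed.

Lemma RtoC_1m_Cmod_sqr (z : C) : RtoC (1 - Cmod z ^ 2)%R = (1 - z * Cconj z)%C.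
Proof. now rewrite RtoC_minus, RtoC_Cmod_sqr. Qed.

Lemma one_minus_Cmod_sqr_neq_0 (z : C) : unit_disk z -> (1 - z * Cconj z)%C <> 0%C.
Proof.
  intros Hz E. rewrite <- RtoC_1m_Cmod_sqr in E. apply RtoC_inj in E.
  pose proof (Cmod_sqr_lt_1 z Hz). lra.
Qed.

Lemma Cconj_neq_0 (z : C) : z <> 0%C -> Cconj z <> 0%C.
Proof.
  intros H E. apply H. rewrite <- (Cconj_conj z), E.
  apply injective_projections; simpl; ring.
Qed.

Lemma Cmod_le_abs (z : C) : Cmod z <= Rabs (Re z) + Rabs (Im z).
Proof.
  replace z with (RtoC (Re z) + Ci * RtoC (Im z))%C at 1
    by (apply injective_projections; simpl; unfold Re, Im; ring).
  eapply Rle_trans; [apply Cmod_triangle|].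
  rewrite Cmod_mult, Cmod_Ci, !Cmod_R. lra.
Qed.

Lemma unit_disk_scale (z : C) (t : R) :
  unit_disk z -> 0 <= t <= 1 -> unit_disk (RtoC t * z).
Proof.
  unfold unit_disk. intros Hz Ht. rewrite Cmod_mult, Cmod_R, Rabs_pos_eq by lra.
  pose proof (Cmod_ge_0 z). nra.
Qed.

Lemma locally_Cmod (z : C) (P : C -> Prop) :
  locally (T := C_UniformSpace) z P <->
  exists d : posreal, forall w, Cmod (w - z) < d -> P w.
Proof.
  rewrite locally_C. split.
  - intros [d H]. exists d. intros w Hw. apply H. exact Hw.
  - intros [d H]. exists d. intros w Hw. apply H. exact Hw.
Qed.

Lemma open_unit_disk : open (T := C_UniformSpace) unit_disk.
Proof.
  intros z Hz. apply locally_Cmod.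
  assert (H : 0 < 1 - Cmod z) by (unfold unit_disk in Hz; lra).
  exists (mkposreal _ H). simpl. intros w Hw. unfold unit_disk.
  replace w with (z + (w - z))%C by ring.
  pose proof (Cmod_triangle z (w - z)). lra.
Qed.

(** The functions are passed explicitly because, left to unification, the sum
    and product lemmas unfold complex operations into pairs of reals. *)
Ltac continuous_algebra :=
  repeat lazymatch goal with
  | |- continuous (fun u => u) _ => apply continuous_id
  | |- continuous (fun u => Cplus (@?f u) (@?g u)) _ => apply (continuous_Cplus _ f g)
  | |- continuous (fun u => Cminus (@?f u) (@?g u)) _ => apply (continuous_Cminus _ f g)
  | |- continuous (fun u => Cmult (@?f u) (@?g u)) _ => apply (continuous_Cmult _ f g)
  | |- continuous (fun u => Cconj (@?f u)) _ => apply (continuous_Cconj _ f)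
  | |- continuous _ _ => first [assumption | apply continuous_const]
  end.

(** * Wirtinger derivatives at a point *)

(** Caratheodory's form of real differentiability: the increment of [f] is
    A(w) (w - z) + B(w) (w - z)* with [A] and [B] continuous at [z].  [p] and [q]
    are the derivatives of [f] with respect to z and zbar.  Compared with a
    little-o remainder, no estimate is needed in the product and chain rules. *)
Definition wirtinger_at (f : C -> C) (z p q : C) : Prop :=
  exists A B : C -> C,
    continuous A z /\ continuous B z /\ A z = p /\ B z = q /\
    forall w : C, f w = (f z + A w * (w - z) + B w * Cconj (w - z))%C.

Lemma wirtinger_const (c z : C) : wirtinger_at (fun _ => c) z 0 0.
Proof.
  exists (fun _ => 0%C), (fun _ => 0%C). repeat split; try apply continuous_const.
  intros w; ring.
Qed.

Lemma wirtinger_id (z : C) : wirtinger_at (fun w => w) z 1 0.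
Proof.
  exists (fun _ => 1%C), (fun _ => 0%C). repeat split; try apply continuous_const.
  intros w; ring.
Qed.

Lemma wirtinger_eq (f : C -> C) (z p q p' q' : C) :
  wirtinger_at f z p q -> p = p' -> q = q' -> wirtinger_at f z p' q'.
Proof. now intros H -> ->. Qed.

Lemma wirtinger_continuous (f : C -> C) (z p q : C) :
  wirtinger_at f z p q -> continuous f z.
Proof.
  intros (A & B & HA & HB & _ & _ & H).
  apply (continuous_ext (fun w => f z + A w * (w - z) + B w * Cconj (w - z))%C).
  { intros w; symmetry; apply H. }
  continuous_algebra.
Qed.

Lemma wirtinger_conj (f : C -> C) (z p q : C) :
  wirtinger_at f z p q ->
  wirtinger_at (fun w => Cconj (f w)) z (Cconj q) (Cconj p).
Proof.
  intros (A & B & HA & HB & <- & <- & H).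
  exists (fun w => Cconj (B w)), (fun w => Cconj (A w)).
  repeat split; continuous_algebra.
  intros w. rewrite (H w), !Cplus_conj, !Cmult_conj, Cconj_conj. ring.
Qed.

Lemma wirtinger_plus (f g : C -> C) (z p q p' q' : C) :
  wirtinger_at f z p q -> wirtinger_at g z p' q' ->
  wirtinger_at (fun w => f w + g w)%C z (p + p') (q + q').
Proof.
  intros (A & B & HA & HB & <- & <- & H) (A' & B' & HA' & HB' & <- & <- & H').
  exists (fun w => A w + A' w)%C, (fun w => B w + B' w)%C.
  repeat split; continuous_algebra.
  intros w. rewrite (H w), (H' w). ring.
Qed.

Lemma wirtinger_mult (f g : C -> C) (z p q p' q' : C) :
  wirtinger_at f z p q -> wirtinger_at g z p' q' ->
  wirtinger_at (fun w => f w * g w)%C z (p * g z + f z * p') (q * g z + f z * q').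
Proof.
  intros Hf (A' & B' & HA' & HB' & <- & <- & H').
  pose proof (wirtinger_continuous _ _ _ _ Hf) as Hc.
  destruct Hf as (A & B & HA & HB & <- & <- & H).
  exists (fun w => A w * g z + f w * A' w)%C, (fun w => B w * g z + f w * B' w)%C.
  repeat split; continuous_algebra.
  intros w. rewrite (H' w).
  transitivity ((f z + A w * (w - z) + B w * Cconj (w - z)) * g z + f w * (A' w * (w-z) + B' w * Cconj (w-z)))%C.
  { rewrite <- H. ring. } ring.
Qed.

Lemma wirtinger_comp (f g : C -> C) (z p q p' q' : C) :
  wirtinger_at g z p q -> wirtinger_at f (g z) p' q' ->
  wirtinger_at (fun w => f (g w)) z
    (p' * p + q' * Cconj q) (p' * q + q' * Cconj p).
Proof.
  intros Hg (A' & B' & HA' & HB' & <- & <- & H').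
  pose proof (wirtinger_continuous _ _ _ _ Hg) as Hc.
  destruct Hg as (A & B & HA & HB & <- & <- & H).
  assert (HA'g : continuous (fun w => A' (g w)) z) by now apply continuous_comp.
  assert (HB'g : continuous (fun w => B' (g w)) z) by now apply continuous_comp.
  exists (fun w => A' (g w) * A w + B' (g w) * Cconj (B w))%C,
         (fun w => A' (g w) * B w + B' (g w) * Cconj (A w))%C.
  repeat split; continuous_algebra.
  intros w. rewrite (H' (g w)).
  replace (g w - g z)%C with (A w * (w - z) + B w * Cconj (w - z))%C by (rewrite (H w); ring).
  rewrite Cplus_conj, !Cmult_conj, Cconj_conj. ring.
Qed.

(** Modifying [f] into [g] away from [z] is absorbed in the factor [A], to which
    (g - f) / (w - z) is added: this vanishes near [z]. *)
Lemma wirtinger_ext_loc (f g : C -> C) (z p q : C) :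
  locally (T := C_UniformSpace) z (fun w => f w = g w) ->
  wirtinger_at f z p q -> wirtinger_at g z p q.
Proof.
  intros Hl (A & B & HA & HB & <- & <- & H).
  pose proof (locally_singleton _ _ Hl) as Hz. simpl in Hz.
  exists (fun w => A w + (g w - f w) / (w - z))%C, B. cbv beta.
  repeat split.
  - apply continuous_ext_loc with A; [|exact HA].
    revert Hl. apply filter_imp. intros w Hw. rewrite Hw.
    transitivity (A w + 0)%C; [symmetry; apply Cplus_0_r|]. f_equal. unfold Cdiv. ring.
  - exact HB.
  - rewrite Hz. unfold Cdiv. ring.
  - intros w. destruct (Ceq_dec w z) as [->|Hne].
    + rewrite Cminus_conj, Hz. unfold Cdiv. ring.
    + rewrite <- Hz.
      transitivity (g w - f w + f w)%C; [ring|]. rewrite (H w) at 2. field.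
      intros E. apply Hne. replace w with (w - z + z)%C by ring. rewrite E. ring.
Qed.

(** The remainder is absorbed in the factor of (w - z) only, since it may be
    divided by w - z. *)
Lemma wirtinger_little_o (f : C -> C) (z p q : C) :
  (forall eps : posreal, locally (T := C_UniformSpace) z (fun w =>
     Cmod (f w - f z - (p * (w - z) + q * Cconj (w - z))) <= eps * Cmod (w - z))) ->
  wirtinger_at f z p q.
Proof.
  intros H.
  set (r := fun w => (f w - f z - (p * (w - z) + q * Cconj (w - z)))%C).
  exists (fun w => p + r w / (w - z))%C, (fun _ => q).
  assert (Hr : (r z / (z - z))%C = 0%C).
  { unfold r. rewrite Cminus_conj. unfold Cdiv. ring. }
  repeat split; try apply continuous_const.
  - apply continuous_Cplus; [apply continuous_const|].
    intros P HP. apply locally_Cmod in HP. destruct HP as [d Hd].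
    assert (Hd2 : 0 < d / 2) by (destruct d; simpl; lra).
    specialize (H (mkposreal _ Hd2)). unfold filtermap. revert H.
    apply filter_imp. simpl. intros w Hw. apply Hd.
    rewrite Hr.
    change (Cmod (r w / (w - z) - 0)%C < d).
    replace (r w / (w - z) - 0)%C with (r w / (w - z))%C by ring.
    destruct (Ceq_dec w z) as [->|Hne].
    + rewrite Hr. rewrite Cmod_0. now destruct d.
    + assert (Hnz : (w - z)%C <> 0%C).
      { intros E. apply Hne. replace w with (w - z + z)%C by ring. rewrite E. ring. }
      rewrite Cmod_div by exact Hnz. apply Cmod_gt_0 in Hnz.
      apply Rle_lt_trans with (d / 2); [|destruct d; simpl in *; lra].
      apply Rle_div_l; [exact Hnz|exact Hw].
  - rewrite Hr. ring.
  - intros w. destruct (Ceq_dec w z) as [->|Hne].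
    + rewrite Cminus_conj. ring.
    + unfold r. field.
      intros E. apply Hne. replace w with (w - z + z)%C by ring. rewrite E. ring.
Qed.

Lemma wirtinger_holomorphic (f : C -> C) (z l : C) :
  @is_derive C_AbsRing C_NormedModule f z l -> wirtinger_at f z l 0.
Proof.
  intros [_ H]. apply wirtinger_little_o. intros eps.
  specialize (H z (fun P HP => HP) eps). apply locally_C. revert H. apply filter_imp.
  intros w Hw.
  replace (f w - f z - (l * (w - z) + 0 * Cconj (w - z)))%C
    with (f w - f z - ((w - z) * l))%C by ring.
  exact Hw.
Qed.

(** [wirtinger_at] restricted to a line has the shape of the second hypothesis. *)
Lemma is_derive_slope (g k : R -> R) (x : R) :
  continuous k x -> (forall t, g t = g x + k t * (t - x)) -> is_derive g x (k x).
Proof.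
  intros Hk Hg. split; [apply is_linear_scal_l|].
  intros y Hy eps.
  apply (is_filter_lim_locally_unique (V := AbsRing_NormedModule R_AbsRing)) in Hy. subst y.
  assert (Hloc : locally x (fun t => Rabs (k t - k x) < eps)).
  { apply (Hk (fun v => Rabs (v - k x) < eps)). exists eps. intros v Hv. exact Hv. }
  revert Hloc. apply filter_imp. intros t Ht.
  unfold norm, minus, plus, opp, scal; simpl. unfold abs, mult; simpl.
  rewrite (Hg t).
  replace (g x + k t * (t - x) + - g x + - ((t + - x) * k x))
    with ((k t - k x) * (t - x)) by ring.
  rewrite Rabs_mult. apply Rmult_le_compat_r; [apply Rabs_pos|]. now apply Rlt_le.
Qed.

Lemma continuous_line (z h : C) (t : R) :
  continuous (fun s : R => (z + RtoC s * h)%C) t.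
Proof.
  apply continuous_Cplus; [apply continuous_const|].
  apply continuous_Cmult; [|apply continuous_const].
  apply continuous_RtoC, continuous_id.
Qed.

(** Both partial derivatives are the cases h = 1 and h = i; rays from the origin
    are the case z = 0. *)
Lemma wirtinger_line (f : C -> C) (z h p q : C) (t : R) :
  wirtinger_at f (z + RtoC t * h) p q ->
  is_derive (fun s : R => Re (f (z + RtoC s * h)%C)) t (Re (p * h + q * Cconj h)) /\
  is_derive (fun s : R => Im (f (z + RtoC s * h)%C)) t (Im (p * h + q * Cconj h)).
Proof.
  intros (A & B & HA & HB & <- & <- & H).
  set (g := fun s : R => (z + RtoC s * h)%C). change (z + RtoC t * h)%C with (g t).
  fold (g t) in HA, HB, H.
  set (k := fun s : R => (A (g s) * h + B (g s) * Cconj h)%C).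
  assert (Hk : continuous k t).
  { assert (HAg : continuous (fun s => A (g s)) t)
      by (apply continuous_comp; [apply continuous_line|exact HA]).
    assert (HBg : continuous (fun s => B (g s)) t)
      by (apply continuous_comp; [apply continuous_line|exact HB]).
    unfold k. continuous_algebra. }
  assert (Hf : forall s, f (g s) = (f (g t) + RtoC (s - t) * k s)%C).
  { intros s. rewrite (H (g s)).
    replace (g s - g t)%C with (RtoC (s - t) * h)%C by (unfold g; rewrite RtoC_minus; ring).
    rewrite Cmult_conj. replace (Cconj (RtoC (s - t))) with (RtoC (s - t)).
    2: { apply injective_projections; simpl; ring. }
    unfold k. ring. }
  split.
  - apply (is_derive_slope (fun s => Re (f (g s))) (fun s => Re (k s))); [now apply continuous_Re|].
    intros s. rewrite (Hf s).
    destruct (f (g t)), (k s). simpl. ring.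
  - apply (is_derive_slope (fun s => Im (f (g s))) (fun s => Im (k s))); [now apply continuous_Im|].
    intros s. rewrite (Hf s).
    destruct (f (g t)), (k s). simpl. ring.
Qed.

Lemma is_derive_ext_eq (f g : R -> R) (x l m : R) :
  is_derive f x l -> (forall t, f t = g t) -> l = m -> is_derive g x m.
Proof. intros H E <-. now apply (is_derive_ext f). Qed.

(** * Wirtinger derivatives and partial derivatives *)

Lemma wirtinger_dx (f : C -> C) (z p q : C) :
  wirtinger_at f z p q -> ex_dx f z /\ dx f z = (p + q)%C.
Proof.
  intros H.
  assert (E : z = ((0, Im z) + RtoC (Re z) * 1)%C)
    by (apply injective_projections; simpl; unfold Re, Im; ring).
  pose proof H as H'. rewrite E in H'.
  destruct (wirtinger_line _ _ _ _ _ _ H') as [H1 H2].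
  assert (E' : forall t, ((0, Im z) + RtoC t * 1)%C = (t, Im z))
    by (intros t; apply injective_projections; simpl; ring).
  assert (Ec : (p * 1 + q * Cconj 1)%C = (p + q)%C)
    by (apply injective_projections; simpl; ring).
  apply (is_derive_ext_eq _ (fun t => Re (f (t, Im z))) _ _ (Re (p + q))) in H1;
    [|intros t; now rewrite E'|now rewrite Ec].
  apply (is_derive_ext_eq _ (fun t => Im (f (t, Im z))) _ _ (Im (p + q))) in H2;
    [|intros t; now rewrite E'|now rewrite Ec].
  split.
  - split; eexists; eassumption.
  - unfold dx. rewrite (is_derive_unique _ _ _ H1), (is_derive_unique _ _ _ H2).
    now destruct (p + q)%C.
Qed.

Lemma wirtinger_dy (f : C -> C) (z p q : C) :
  wirtinger_at f z p q -> ex_dy f z /\ dy f z = (Ci * (p - q))%C.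
Proof.
  intros H.
  assert (E : z = ((Re z, 0) + RtoC (Im z) * Ci)%C)
    by (apply injective_projections; simpl; unfold Re, Im; ring).
  pose proof H as H'. rewrite E in H'.
  destruct (wirtinger_line _ _ _ _ _ _ H') as [H1 H2].
  assert (E' : forall t, ((Re z, 0) + RtoC t * Ci)%C = (Re z, t))
    by (intros t; apply injective_projections; simpl; ring).
  assert (Ec : (p * Ci + q * Cconj Ci)%C = (Ci * (p - q))%C)
    by (apply injective_projections; simpl; ring).
  apply (is_derive_ext_eq _ (fun t => Re (f (Re z, t))) _ _ (Re (Ci * (p - q)))) in H1;
    [|intros t; now rewrite E'|now rewrite Ec].
  apply (is_derive_ext_eq _ (fun t => Im (f (Re z, t))) _ _ (Im (Ci * (p - q)))) in H2;
    [|intros t; now rewrite E'|now rewrite Ec].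
  split.
  - split; eexists; eassumption.
  - unfold dy. rewrite (is_derive_unique _ _ _ H1), (is_derive_unique _ _ _ H2).
    now destruct (Ci * (p - q))%C.
Qed.

(** With [wirtinger_d_zbar], the derivatives in [wirtinger_at] are unique; this is
    how equations between functions are differentiated. *)
Lemma wirtinger_d_z (f : C -> C) (z p q : C) :
  wirtinger_at f z p q -> d_z f z = p.
Proof.
  intros H. unfold d_z.
  rewrite (proj2 (wirtinger_dx _ _ _ _ H)), (proj2 (wirtinger_dy _ _ _ _ H)).
  apply injective_projections; simpl; field.
Qed.

Lemma wirtinger_d_zbar (f : C -> C) (z p q : C) :
  wirtinger_at f z p q -> d_zbar f z = q.
Proof.
  intros H. unfold d_zbar.
  rewrite (proj2 (wirtinger_dx _ _ _ _ H)), (proj2 (wirtinger_dy _ _ _ _ H)).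
  apply injective_projections; simpl; field.
Qed.

(** The derivative may be undetermined at the origin itself, where only
    continuity is asked: this is the case of psi', controlled by z psi'' = 0. *)
Lemma constant_on_ray (g : C -> C) (z : C) :
  (forall t, 0 < t < 1 -> exists p q,
     wirtinger_at g (RtoC t * z) p q /\ (p * z + q * Cconj z)%C = 0%C) ->
  (forall t, 0 <= t <= 1 -> continuous g (RtoC t * z)%C) ->
  g z = g 0%C.
Proof.
  intros Hd Hc.
  assert (E : forall t, (0 + RtoC t * z)%C = (RtoC t * z)%C) by (intros; ring).
  assert (K : forall t, 0 < t < 1 ->
     is_derive (fun s => Re (g (0 + RtoC s * z)%C)) t 0 /\
     is_derive (fun s => Im (g (0 + RtoC s * z)%C)) t 0).
  { intros t Ht. destruct (Hd t Ht) as (p & q & Hw & H0). rewrite <- E in Hw.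
    destruct (wirtinger_line _ _ _ _ _ _ Hw) as [H1 H2].
    rewrite H0 in H1, H2. split; assumption. }
  assert (Kc : forall t, 0 <= t <= 1 -> continuous (fun s => g (0 + RtoC s * z)%C) t).
  { intros t Ht. apply continuous_comp; [apply continuous_line|]. rewrite E. now apply Hc. }
  assert (E1 : g z = g (0 + RtoC 1 * z)%C) by (f_equal; ring).
  assert (E0 : g 0%C = g (0 + RtoC 0 * z)%C) by (f_equal; ring).
  rewrite E1, E0.
  apply injective_projections.
  - destruct (MVT_gen (fun s => Re (g (0 + RtoC s * z)%C)) 0 1 (fun _ => 0)) as (c & _ & H).
    + intros t. rewrite Rmin_left, Rmax_right by lra. apply K.
    + intros t. rewrite Rmin_left, Rmax_right by lra. intros Ht.
      apply continuity_pt_filterlim. now apply continuous_Re, Kc.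
    + unfold Re in H. lra.
  - destruct (MVT_gen (fun s => Im (g (0 + RtoC s * z)%C)) 0 1 (fun _ => 0)) as (c & _ & H).
    + intros t. rewrite Rmin_left, Rmax_right by lra. apply K.
    + intros t. rewrite Rmin_left, Rmax_right by lra. intros Ht.
      apply continuity_pt_filterlim. now apply continuous_Im, Kc.
    + unfold Im in H. lra.
Qed.

(** * Continuously differentiable functions on an open set *)

Lemma C1_differentiable (u v : R * R -> R) (a b vy : R) :
  locally (T := C_UniformSpace) (a, b) (fun w => is_derive (fun t => u (t, snd w)) (fst w) (v w)) ->
  is_derive (fun t => u (a, t)) b vy ->
  continuous (U := R_UniformSpace) (T := C_UniformSpace) v (a, b) ->
  forall eps : posreal, locally (T := C_UniformSpace) (a, b) (fun w =>
    Rabs (u w - u (a, b) - ((fst w - a) * v (a, b) + (snd w - b) * vy))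
      <= eps * Cmod (w - (a, b))).
Proof.
  intros H1 H2 H3 eps.
  pose proof (is_derive_filterdiff (fun x y => u (x, y)) a b (fun x y => v (x, y)) vy) as F.
  destruct F as [_ F].
  - revert H1. apply filter_imp. intros [x y]. simpl. exact (fun H => H).
  - exact H2.
  - apply (continuous_ext v); [now intros [x y]|exact H3].
  - specialize (F (a, b) (fun P HP => HP) eps). revert F. apply filter_imp.
    intros [x y] Hw. rewrite Cmod_norm. exact Hw.
Qed.

(** Together with [C1_on_of_wirtinger], this makes C1 regularity a statement about
    Wirtinger derivatives, to which the rules above apply. *)
Lemma C1_on_wirtinger (U : C -> Prop) (f : C -> C) (z : C) :
  open (T := C_UniformSpace) U -> C1_on U f -> U z ->
  wirtinger_at f z (d_z f z) (d_zbar f z).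
Proof.
  intros HU HC Hz. apply wirtinger_little_o. intros eps.
  destruct (HC z Hz) as (_ & [Hy1 Hy2] & Hc & _).
  assert (Heps : 0 < eps / 2) by (destruct eps; simpl; lra).
  pose proof (HU z Hz) as HUz.
  destruct z as [a b].
  assert (L1 : locally (T := C_UniformSpace) (a, b) (fun w =>
            is_derive (fun t => Re (f (t, snd w))) (fst w) (Re (dx f w)))).
  { revert HUz. apply filter_imp. intros w Hw.
    destruct (HC w Hw) as ([Hx1 Hx2] & _). now apply Derive_correct. }
  assert (L2 : locally (T := C_UniformSpace) (a, b) (fun w =>
            is_derive (fun t => Im (f (t, snd w))) (fst w) (Im (dx f w)))).
  { revert HUz. apply filter_imp. intros w Hw.
    destruct (HC w Hw) as ([Hx1 Hx2] & _). now apply Derive_correct. }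
  pose proof (C1_differentiable (fun w => Re (f w)) (fun w => Re (dx f w)) a b _
     L1 (Derive_correct _ _ Hy1) (continuous_Re _ _ _ Hc) (mkposreal _ Heps)) as D1.
  pose proof (C1_differentiable (fun w => Im (f w)) (fun w => Im (dx f w)) a b _
     L2 (Derive_correct _ _ Hy2) (continuous_Im _ _ _ Hc) (mkposreal _ Heps)) as D2.
  generalize (filter_and _ _ D1 D2). apply filter_imp. clear.
  intros w [D1 D2]. simpl in D1, D2.
  eapply Rle_trans; [apply Cmod_le_abs|].
  match goal with |- Rabs ?X + Rabs ?Y <= _ =>
   match type of D1 with Rabs ?X' <= _ => replace X with X' end;
   [match type of D2 with Rabs ?Y' <= _ => replace Y with Y' end|]
  end.
  - lra.
  - unfold d_z, d_zbar, dx, dy, Re, Im; simpl; unfold Re, Im; simpl. field.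
  - unfold d_z, d_zbar, dx, dy, Re, Im; simpl; unfold Re, Im; simpl. field.
Qed.

Lemma C1_on_of_wirtinger (U : C -> Prop) (f p q : C -> C) :
  open (T := C_UniformSpace) U ->
  (forall z, U z -> wirtinger_at f z (p z) (q z)) ->
  (forall z, U z -> continuous p z) -> (forall z, U z -> continuous q z) ->
  C1_on U f.
Proof.
  intros HU H Hp Hq z Hz. pose proof (HU z Hz) as HUz.
  specialize (Hp z Hz). specialize (Hq z Hz).
  repeat split.
  - apply (wirtinger_dx _ _ _ _ (H z Hz)).
  - apply (wirtinger_dx _ _ _ _ (H z Hz)).
  - apply (wirtinger_dy _ _ _ _ (H z Hz)).
  - apply (wirtinger_dy _ _ _ _ (H z Hz)).
  - apply continuous_ext_loc with (fun w => (p w + q w)%C); [|continuous_algebra].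
    revert HUz. apply filter_imp. intros w Hw. symmetry.
    apply (wirtinger_dx _ _ _ _ (H w Hw)).
  - apply continuous_ext_loc with (fun w => (Ci * (p w - q w))%C); [|continuous_algebra].
    revert HUz. apply filter_imp. intros w Hw. symmetry.
    apply (wirtinger_dy _ _ _ _ (H w Hw)).
Qed.

Lemma C1_on_continuous_d_z (U : C -> Prop) (f : C -> C) (z : C) :
  C1_on U f -> U z -> continuous (d_z f) z.
Proof.
  intros H Hz. destruct (H z Hz) as (_ & _ & H1 & H2).
  change (continuous (fun z => RtoC (/ 2) * (dx f z - Ci * dy f z))%C z). continuous_algebra.
Qed.

Lemma C1_on_continuous_d_zbar (U : C -> Prop) (f : C -> C) (z : C) :
  C1_on U f -> U z -> continuous (d_zbar f) z.
Proof.
  intros H Hz. destruct (H z Hz) as (_ & _ & H1 & H2).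
  change (continuous (fun z => RtoC (/ 2) * (dx f z + Ci * dy f z))%C z). continuous_algebra.
Qed.

Section OnOpenSet.
Variable U : C -> Prop.
Hypothesis U_open : open (T := C_UniformSpace) U.

Lemma C1_on_continuous (f : C -> C) (z : C) : C1_on U f -> U z -> continuous f z.
Proof.
  intros H Hz. exact (wirtinger_continuous _ _ _ _ (C1_on_wirtinger U f z U_open H Hz)).
Qed.

Lemma C1_on_ext (f g : C -> C) :
  (forall z, U z -> f z = g z) -> C1_on U f -> C1_on U g.
Proof.
  intros E H. apply (C1_on_of_wirtinger U g (d_z f) (d_zbar f) U_open).
  - intros z Hz. apply (wirtinger_ext_loc f); [|now apply (C1_on_wirtinger U)].
    generalize (U_open z Hz). now apply filter_imp.
  - intros z Hz. now apply (C1_on_continuous_d_z U).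
  - intros z Hz. now apply (C1_on_continuous_d_zbar U).
Qed.

Lemma C1_on_const (c : C) : C1_on U (fun _ => c).
Proof.
  apply (C1_on_of_wirtinger U _ (fun _ => 0%C) (fun _ => 0%C) U_open);
    intros; try apply continuous_const. apply wirtinger_const.
Qed.

Lemma C1_on_id : C1_on U (fun z => z).
Proof.
  apply (C1_on_of_wirtinger U _ (fun _ => 1%C) (fun _ => 0%C) U_open);
    intros; try apply continuous_const. apply wirtinger_id.
Qed.

Ltac C1_continuous :=
  repeat match goal with
  | H : C1_on ?V ?f |- continuous (d_z ?f) _ => now apply (C1_on_continuous_d_z V)
  | H : C1_on ?V ?f |- continuous (fun u => d_z ?f u) _ => now apply (C1_on_continuous_d_z V)
  | H : C1_on ?V ?f |- continuous (d_zbar ?f) _ => now apply (C1_on_continuous_d_zbar V)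
  | H : C1_on ?V ?f |- continuous (fun u => d_zbar ?f u) _ => now apply (C1_on_continuous_d_zbar V)
  | H : C1_on U ?f |- continuous (fun u => ?f u) _ => now apply (C1_on_continuous f)
  | _ => progress continuous_algebra
  end.

Lemma C1_on_conj (f : C -> C) : C1_on U f -> C1_on U (fun z => Cconj (f z)).
Proof.
  intros H. eapply (C1_on_of_wirtinger U _ (fun z => Cconj (d_zbar f z)) (fun z => Cconj (d_z f z)) U_open);
   intros z Hz; [|C1_continuous|C1_continuous].
  now apply wirtinger_conj, (C1_on_wirtinger U).
Qed.

Lemma C1_on_plus (f g : C -> C) : C1_on U f -> C1_on U g -> C1_on U (fun z => f z + g z)%C.
Proof.
  intros Hf Hg.
  apply (C1_on_of_wirtinger U _ (fun z => d_z f z + d_z g z)%C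
     (fun z => d_zbar f z + d_zbar g z)%C U_open); intros z Hz; [|C1_continuous|C1_continuous].
  now apply wirtinger_plus; apply (C1_on_wirtinger U).
Qed.

Lemma C1_on_mult (f g : C -> C) : C1_on U f -> C1_on U g -> C1_on U (fun z => f z * g z)%C.
Proof.
  intros Hf Hg.
  apply (C1_on_of_wirtinger U _ (fun z => d_z f z * g z + f z * d_z g z)%C
     (fun z => d_zbar f z * g z + f z * d_zbar g z)%C U_open); intros z Hz; [|C1_continuous|C1_continuous].
  now apply wirtinger_mult; apply (C1_on_wirtinger U).
Qed.

Ltac C1_algebra :=
  repeat lazymatch goal with
  | |- C1_on U (fun z => z) => apply C1_on_id
  | |- C1_on U (fun z => Cplus (@?f z) (@?g z)) => apply (C1_on_plus f g)
  | |- C1_on U (fun z => Cmult (@?f z) (@?g z)) => apply (C1_on_mult f g)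
  | |- C1_on U (fun z => Cconj (@?f z)) => apply (C1_on_conj f)
  | |- C1_on U _ => first [assumption | apply C1_on_const]
  end.

(** Second order regularity is checked on the Wirtinger derivatives, of which the
    partial derivatives are linear combinations. *)
Lemma C2_on_of_wirtinger (f p q : C -> C) :
  (forall z, U z -> wirtinger_at f z (p z) (q z)) -> C1_on U p -> C1_on U q -> C2_on U f.
Proof.
  intros H Hp Hq. split; [|split].
  - apply (C1_on_of_wirtinger U f p q U_open H); intros z Hz; now apply C1_on_continuous.
  - apply (C1_on_ext (fun z => p z + q z)%C); [|now apply C1_on_plus].
    intros z Hz. symmetry. apply (wirtinger_dx _ _ _ _ (H z Hz)).
  - apply (C1_on_ext (fun z => Ci * (p z + (-(1)) * q z))%C).
    + intros z Hz. rewrite (proj2 (wirtinger_dy _ _ _ _ (H z Hz))). ring.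
    + C1_algebra.
Qed.

Lemma C2_on_d_z (f : C -> C) : C2_on U f -> C1_on U (d_z f).
Proof.
  intros (_ & H1 & H2).
  apply (C1_on_ext (fun z => RtoC (/ 2) * (dx f z + (- Ci) * dy f z))%C).
  - intros z _. unfold d_z. ring.
  - C1_algebra.
Qed.

Lemma C2_on_d_zbar (f : C -> C) : C2_on U f -> C1_on U (d_zbar f).
Proof.
  intros (_ & H1 & H2).
  apply (C1_on_ext (fun z => RtoC (/ 2) * (dx f z + Ci * dy f z))%C).
  - intros z _. reflexivity.
  - C1_algebra.
Qed.

Lemma C1_on_comp (V : C -> Prop) (f g : C -> C) :
  open (T := C_UniformSpace) V -> C1_on V f -> C1_on U g ->
  (forall z, U z -> V (g z)) -> C1_on U (fun z => f (g z)).
Proof.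
  intros HV Hf Hg Hm.
  assert (Hc : forall (h : C -> C) z, U z -> continuous h (g z) -> continuous (fun w => h (g w)) z).
  { intros h z Hz Hh. apply continuous_comp; [now apply C1_on_continuous|exact Hh]. }
  assert (H1 : forall z, U z -> continuous (fun w => d_z f (g w)) z).
  { intros z Hz. apply Hc; [exact Hz|]. apply (C1_on_continuous_d_z V); auto. }
  assert (H2 : forall z, U z -> continuous (fun w => d_zbar f (g w)) z).
  { intros z Hz. apply Hc; [exact Hz|]. apply (C1_on_continuous_d_zbar V); auto. }
  apply (C1_on_of_wirtinger U _
     (fun z => d_z f (g z) * d_z g z + d_zbar f (g z) * Cconj (d_zbar g z))%C
     (fun z => d_z f (g z) * d_zbar g z + d_zbar f (g z) * Cconj (d_z g z))%C U_open);
   intros z Hz.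
  - apply wirtinger_comp; [now apply (C1_on_wirtinger U)|apply (C1_on_wirtinger V); auto].
  - specialize (H1 z Hz). specialize (H2 z Hz). C1_continuous.
  - specialize (H1 z Hz). specialize (H2 z Hz). C1_continuous.
Qed.

Lemma C2_on_schwarz (f : C -> C) (z : C) :
  C2_on U f -> U z -> dy (dx f) z = dx (dy f) z.
Proof.
  intros (H0 & H1 & H2) Hz. destruct z as [a b].
  assert (L : locally_2d (fun u v => U (u, v)) a b).
  { apply locally_2d_locally. generalize (U_open _ Hz). apply filter_imp. now intros [u v]. }
  destruct (H1 _ Hz) as (_ & _ & _ & C1). destruct (H2 _ Hz) as (_ & _ & C2 & _).
  apply injective_projections; simpl; symmetry.
  - apply (Schwarz (fun u v => Re (f (u, v))) a b).
    + revert L. apply locally_2d_impl, locally_2d_forall. intros u v Huv.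
      destruct (H0 _ Huv) as ([X _] & [Y _] & _).
      destruct (H1 _ Huv) as (_ & [Y1 _] & _). destruct (H2 _ Huv) as ([X1 _] & _).
      exact (conj X (conj Y (conj X1 Y1))).
    + apply continuity_2d_pt_filterlim.
      apply (continuous_ext (fun w => Re (dx (dy f) w))); [now intros [u v]|now apply continuous_Re].
    + apply continuity_2d_pt_filterlim.
      apply (continuous_ext (fun w => Re (dy (dx f) w))); [now intros [u v]|now apply continuous_Re].
  - apply (Schwarz (fun u v => Im (f (u, v))) a b).
    + revert L. apply locally_2d_impl, locally_2d_forall. intros u v Huv.
      destruct (H0 _ Huv) as ([_ X] & [_ Y] & _).
      destruct (H1 _ Huv) as (_ & [_ Y1] & _). destruct (H2 _ Huv) as ([_ X1] & _).
      exact (conj X (conj Y (conj X1 Y1))).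
    + apply continuity_2d_pt_filterlim.
      apply (continuous_ext (fun w => Im (dx (dy f) w))); [now intros [u v]|now apply continuous_Im].
    + apply continuity_2d_pt_filterlim.
      apply (continuous_ext (fun w => Im (dy (dx f) w))); [now intros [u v]|now apply continuous_Im].
Qed.

(** The Cauchy-Riemann equation dy f = i dx f, differentiated in x, gives
    dy (dx f) = dx (dy f) = i dx (dx f), the Cauchy-Riemann equation of dx f. *)
Lemma holomorphic_derivative (f : C -> C) :
  (forall z, U z -> wirtinger_at f z (dx f z) 0) -> C2_on U f ->
  forall z, U z -> wirtinger_at (dx f) z (dx (dx f) z) 0.
Proof.
  intros Hf H2 z Hz.
  pose proof (C1_on_wirtinger U (dx f) z U_open (proj1 (proj2 H2)) Hz) as HD.
  assert (Hdy : dx (dy f) z = (Ci * dx (dx f) z)%C).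
  { pose proof (wirtinger_mult _ _ _ _ _ _ _ (wirtinger_const Ci z) HD) as HM.
    apply (wirtinger_ext_loc _ (dy f)) in HM.
    - rewrite (proj2 (wirtinger_dx _ _ _ _ HM)), (proj2 (wirtinger_dx _ _ _ _ HD)). ring.
    - generalize (U_open z Hz). apply filter_imp. intros w Hw.
      rewrite (proj2 (wirtinger_dy _ _ _ _ (Hf w Hw))). ring. }
  pose proof (C2_on_schwarz f z H2 Hz) as S. rewrite Hdy in S.
  apply (wirtinger_eq _ _ _ _ _ _ HD).
  - unfold d_z. rewrite S. apply injective_projections; simpl; field.
  - unfold d_zbar. rewrite S. apply injective_projections; simpl; field.
Qed.

End OnOpenSet.

(** * Radial functions *)

(** The converse of [is_derive_slope]. *)
Lemma is_derive_has_slope (g : R -> R) (x l : R) :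
  is_derive g x l ->
  exists k : R -> R, continuous k x /\ k x = l /\ forall t, g t = g x + k t * (t - x).
Proof.
  intros [_ H].
  exists (fun t => l + (g t - g x - (t - x) * l) / (t - x)).
  assert (E : forall y, l + (g y - g y - (y - y) * l) / (y - y) = l).
  { intros y. replace (g y - g y - (y - y) * l) with 0 by ring. unfold Rdiv. ring. }
  repeat split.
  - intros P. rewrite E. intros [d Hd].
    assert (Hd2 : 0 < d / 2) by (destruct d; simpl; lra).
    specialize (H x (fun P HP => HP) (mkposreal _ Hd2)). unfold filtermap. revert H.
    apply filter_imp. intros t Ht. apply Hd.
    unfold ball; simpl. unfold AbsRing_ball, minus, plus, opp, abs; simpl.
    replace (l + (g t - g x - (t - x) * l) / (t - x) + - l)
      with ((g t - g x - (t - x) * l) / (t - x)) by ring.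
    destruct (Req_dec t x) as [->|Hne].
    + replace (g x - g x - (x - x) * l) with 0 by ring. unfold Rdiv.
      rewrite Rmult_0_l, Rabs_R0. apply cond_pos.
    + assert (Ha : 0 < Rabs (t - x)) by (apply Rabs_pos_lt; lra).
      rewrite Rabs_div by lra.
      apply Rle_lt_trans with (d / 2); [|destruct d; simpl in *; lra].
      apply Rle_div_l; [exact Ha|exact Ht].
  - apply E.
  - intros t. destruct (Req_dec t x) as [->|Hne]; [ring|]. field. lra.
Qed.

(** The increment |w|^2 - |z|^2 equals w* (w - z) + z (w - z)*, which is already
    in the form required by [wirtinger_at]. *)
Lemma wirtinger_radial (phi : R -> R) (z : C) (l : R) :
  is_derive phi (Cmod z ^ 2) l ->
  wirtinger_at (fun w => RtoC (phi (Cmod w ^ 2)%R)) z (RtoC l * Cconj z) (RtoC l * z).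
Proof.
  intros H. destruct (is_derive_has_slope _ _ _ H) as (k & Hk & <- & E).
  assert (Hc : continuous (fun w => RtoC (k (Cmod w ^ 2)%R)) z).
  { apply continuous_RtoC, continuous_comp; [|exact Hk].
    apply (continuous_ext (fun w => Re (w * Cconj w))).
    - intros w. now rewrite <- RtoC_Cmod_sqr.
    - apply continuous_Re. continuous_algebra. }
  exists (fun w => RtoC (k (Cmod w ^ 2)%R) * Cconj w)%C,
         (fun w => RtoC (k (Cmod w ^ 2)%R) * z)%C.
  repeat split; continuous_algebra.
  intros w. rewrite (E (Cmod w ^ 2)%R).
  rewrite RtoC_plus, RtoC_mult, RtoC_minus, !RtoC_Cmod_sqr, Cminus_conj. ring.
Qed.

Lemma C1_on_radial (phi dphi : R -> R) :
  (forall s, s < 1 -> is_derive phi s (dphi s)) ->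
  (forall s, s < 1 -> continuous dphi s) ->
  C1_on unit_disk (fun z => RtoC (phi (Cmod z ^ 2)%R)).
Proof.
  intros H Hc.
  assert (Hk : forall z, unit_disk z -> continuous (fun w => RtoC (dphi (Cmod w ^ 2)%R)) z).
  { intros z Hz. apply continuous_RtoC, continuous_comp; [|now apply Hc, Cmod_sqr_lt_1].
    apply (continuous_ext (fun w => Re (w * Cconj w))).
    - intros w. now rewrite <- RtoC_Cmod_sqr.
    - apply continuous_Re. continuous_algebra. }
  apply (C1_on_of_wirtinger unit_disk _ (fun z => RtoC (dphi (Cmod z ^ 2)%R) * Cconj z)%C
   (fun z => RtoC (dphi (Cmod z ^ 2)%R) * z)%C open_unit_disk); intros z Hz.
  - now apply wirtinger_radial, H, Cmod_sqr_lt_1.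
  - specialize (Hk z Hz). continuous_algebra.
  - specialize (Hk z Hz). continuous_algebra.
Qed.

(** * Integrals of powers of 1 - s u *)

Lemma is_derive_Rpower (x b : R) :
  0 < x -> is_derive (fun y => Rpower y b) x (b * Rpower x (b - 1)).
Proof. intros H. apply is_derive_Reals. now apply derivable_pt_lim_power. Qed.

Lemma is_derive_Rpower_1m (s b : R) :
  s < 1 -> is_derive (fun y => Rpower (1 - y) b) s (- b * Rpower (1 - s) (b - 1)).
Proof.
  intros H.
  apply (is_derive_ext_eq (fun y => Rpower (1 - y) b) _ s (-1 * (b * Rpower (1 - s) (b - 1))));
    [|reflexivity|ring].
  apply (is_derive_comp (fun y => Rpower y b) (fun y => 1 - y)).
  - apply is_derive_Rpower. lra.
  - auto_derive; [exact I|ring].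
Qed.

Lemma Rpower_pred (x b : R) : 0 < x -> Rpower x (b - 1) = Rpower x b / x.
Proof.
  intros Hx. unfold Rminus. rewrite Rpower_plus, Rpower_Ropp, Rpower_1 by exact Hx. reflexivity.
Qed.

(** The function F of the test function is [moment alpha 0]; the other exponents
    and powers of u appear in its successive derivatives. *)
Definition moment (b : R) (n : nat) (s : R) : R :=
  RInt (fun u => u ^ n * Rpower (1 - s * u) b) 0 1.

Lemma is_derive_kernel (b : R) (n : nat) (s u : R) :
  0 < 1 - s * u ->
  is_derive (fun y => u ^ n * Rpower (1 - y * u) b) s
    (- b * (u ^ S n * Rpower (1 - s * u) (b - 1))).
Proof.
  intros H.
  apply (is_derive_ext_eq (fun y => u ^ n * Rpower (1 - y * u) b) _ s
    (u ^ n * (- u * (b * Rpower (1 - s * u) (b - 1)))));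
    [|reflexivity|simpl; ring].
  apply is_derive_scal.
  apply (is_derive_comp (fun y => Rpower y b) (fun y => 1 - y * u)).
  - now apply is_derive_Rpower.
  - auto_derive; [exact I|ring].
Qed.

Lemma kernel_pos (s u : R) : s < 1 -> 0 <= u <= 1 -> 0 < 1 - s * u.
Proof. intros Hs Hu. destruct (Rle_lt_dec s 0); nra. Qed.

Lemma continuity_2d_kernel (b : R) (n : nat) (s u : R) :
  0 < 1 - s * u ->
  continuity_2d_pt (fun x v => v ^ n * Rpower (1 - x * v) b) s u.
Proof.
  intros H. apply continuity_2d_pt_mult.
  - apply (continuity_1d_2d_pt_comp (fun v => v ^ n) (fun _ v => v)).
    + apply derivable_continuous_pt, derivable_pt_pow.
    + apply continuity_2d_pt_id2.
  - apply (continuity_1d_2d_pt_comp (fun v => Rpower v b) (fun x v => 1 - x * v)).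
    + apply continuity_pt_filterlim.
      apply (ex_derive_continuous (fun v => Rpower v b)). eexists. now apply is_derive_Rpower.
    + apply continuity_2d_pt_minus; [apply continuity_2d_pt_const|].
      apply continuity_2d_pt_mult; [apply continuity_2d_pt_id1|apply continuity_2d_pt_id2].
Qed.

Lemma ex_RInt_kernel (b : R) (n : nat) (s : R) :
  s < 1 -> ex_RInt (fun u => u ^ n * Rpower (1 - s * u) b) 0 1.
Proof.
  intros Hs. apply (ex_RInt_continuous (V := R_CompleteNormedModule)). intros u Hu.
  rewrite Rmin_left, Rmax_right in Hu by lra.
  pose proof (kernel_pos s u Hs Hu) as Hp.
  apply continuity_pt_filterlim.
  intros eps Heps.
  destruct (continuity_2d_kernel b n s u Hp (mkposreal eps Heps)) as [d Hd].
  exists d. split; [apply cond_pos|].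
  intros v [_ Hv]. apply Hd; [rewrite Rminus_diag, Rabs_R0; apply cond_pos|exact Hv].
Qed.

Lemma locally_lt_1 (s : R) : s < 1 -> locally s (fun y => y < 1).
Proof. intros H. now apply (open_lt 1). Qed.

Lemma is_derive_moment (b : R) (n : nat) (s : R) :
  s < 1 -> is_derive (moment b n) s (- b * moment (b - 1) (S n) s).
Proof.
  intros Hs. unfold moment at 2.
  rewrite <- (RInt_scal (V := R_CompleteNormedModule)) by now apply ex_RInt_kernel.
  rewrite (RInt_ext _ (fun u => Derive (fun y => u ^ n * Rpower (1 - y * u) b) s)).
  2: { intros u Hu. rewrite Rmin_left, Rmax_right in Hu by lra.
       symmetry. apply is_derive_unique, is_derive_kernel, kernel_pos; lra. }
  apply (is_derive_RInt_param (fun y u => u ^ n * Rpower (1 - y * u) b)).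
  - generalize (locally_lt_1 s Hs). apply filter_imp. intros y Hy u Hu.
    rewrite Rmin_left, Rmax_right in Hu by lra.
    eexists. apply is_derive_kernel. now apply kernel_pos.
  - intros u Hu. rewrite Rmin_left, Rmax_right in Hu by lra.
    pose proof (kernel_pos s u Hs Hu) as Hp.
    apply (continuity_2d_pt_ext_loc (fun x v => - b * (v ^ S n * Rpower (1 - x * v) (b - 1)))).
    + assert (Hc : continuity_2d_pt (fun x v => 1 - x * v) s u).
      { apply continuity_2d_pt_minus; [apply continuity_2d_pt_const|].
        apply continuity_2d_pt_mult; [apply continuity_2d_pt_id1|apply continuity_2d_pt_id2]. }
      destruct (Hc (mkposreal _ Hp)) as [d Hd]. exists d. intros x v Hx Hv.
      specialize (Hd x v Hx Hv). simpl in Hd. apply Rabs_lt_between in Hd.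
      symmetry. apply is_derive_unique, is_derive_kernel. lra.
    + apply continuity_2d_pt_mult; [apply continuity_2d_pt_const|].
      now apply continuity_2d_kernel.
  - generalize (locally_lt_1 s Hs). apply filter_imp. intros y Hy. now apply ex_RInt_kernel.
Qed.

(** The left-hand side is F + s F' for F = [moment b 0], and its integrand is the
    derivative of u (1 - s u)^b. *)
Lemma moment_identity (b : R) (s : R) :
  s < 1 -> moment b 0 s + s * (- b * moment (b - 1) 1 s) = Rpower (1 - s) b.
Proof.
  intros Hs.
  assert (H : is_RInt (fun u => Rpower (1 - s * u) b + u * (- (b * s) * Rpower (1 - s * u) (b - 1)))
                0 1 (1 * Rpower (1 - s * 1) b - 0 * Rpower (1 - s * 0) b)).
  { apply (is_RInt_derive (fun u => u * Rpower (1 - s * u) b)).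
    - intros u Hu. rewrite Rmin_left, Rmax_right in Hu by lra.
      pose proof (kernel_pos s u Hs Hu) as Hp.
      apply (is_derive_ext_eq (fun u => u * Rpower (1 - s * u) b) _ u
        (1 * Rpower (1 - s * u) b + u * (- s * (b * Rpower (1 - s * u) (b - 1)))));
       [|reflexivity|ring].
      apply (is_derive_mult (fun u => u) (fun u => Rpower (1 - s * u) b)).
      + apply (is_derive_id (K := R_AbsRing)).
      + apply (is_derive_comp (fun y => Rpower y b) (fun y => 1 - s * y)).
        * now apply is_derive_Rpower.
        * auto_derive; [exact I|ring].
      + intros; apply Rmult_comm.
    - intros u Hu. rewrite Rmin_left, Rmax_right in Hu by lra.
      pose proof (kernel_pos s u Hs Hu) as Hp.
      assert (Hc : forall c, continuous (fun u => Rpower (1 - s * u) c) u).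
      { intros c. apply (ex_derive_continuous (fun u => Rpower (1 - s * u) c)). eexists.
        apply (is_derive_comp (fun y => Rpower y c) (fun y => 1 - s * y)).
        * now apply is_derive_Rpower.
        * auto_derive; [exact I|reflexivity]. }
      apply (continuous_plus (fun u => Rpower (1 - s * u) b)); [apply Hc|].
      apply (continuous_mult (K := R_AbsRing) (fun u => u)); [exact (continuous_id (U := R_UniformSpace) u)|].
      apply (continuous_mult (K := R_AbsRing) (fun _ => - (b * s))); [apply continuous_const|apply Hc]. }
  assert (H' : is_RInt (fun u => Rpower (1 - s * u) b + u * (- (b * s) * Rpower (1 - s * u) (b - 1)))
                0 1 (moment b 0 s + - (b * s) * moment (b - 1) 1 s)).
  { apply (is_RInt_ext (fun u => plus (u ^ 0 * Rpower (1 - s * u) b)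
       (scal (- (b * s)) (u ^ 1 * Rpower (1 - s * u) (b - 1))))).
    - intros u _. unfold plus, scal; simpl. unfold mult; simpl. ring.
    - apply (is_RInt_plus (V := R_NormedModule)).
      + apply (RInt_correct (V := R_CompleteNormedModule)). now apply ex_RInt_kernel.
      + apply (is_RInt_scal (V := R_NormedModule)).
        apply (RInt_correct (V := R_CompleteNormedModule)). now apply ex_RInt_kernel. }
  apply (is_RInt_unique (V := R_CompleteNormedModule)) in H.
  apply (is_RInt_unique (V := R_CompleteNormedModule)) in H'.
  rewrite H' in H. rewrite Rmult_1_r in H. lra.
Qed.

(** * Two alpha-harmonic functions *)

(** With exponent alpha, this is the inverse of the weight of the operator. *)
Definition weight (b : R) (z : C) : C := RtoC (Rpower (1 - Cmod z ^ 2) b).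

Lemma wirtinger_weight (b : R) (z : C) :
  unit_disk z ->
  wirtinger_at (weight b) z
    (RtoC (- b * Rpower (1 - Cmod z ^ 2) (b - 1)) * Cconj z)
    (RtoC (- b * Rpower (1 - Cmod z ^ 2) (b - 1)) * z).
Proof.
  intros Hz. apply (wirtinger_radial (fun s => Rpower (1 - s) b)).
  now apply is_derive_Rpower_1m, Cmod_sqr_lt_1.
Qed.

Lemma weight_mult_opp (b : R) (z : C) : (weight (- b) z * weight b z)%C = 1%C.
Proof.
  unfold weight. rewrite <- RtoC_mult, <- Rpower_plus.
  replace (- b + b) with 0 by ring. unfold Rpower. now rewrite Rmult_0_l, exp_0.
Qed.

Lemma Delta_alpha_of_wirtinger (alpha : R) (f q : C -> C) (z r s : C) :
  unit_disk z ->
  (forall w, unit_disk w -> d_zbar f w = q w) ->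
  wirtinger_at (fun w => weight (- alpha) w * q w)%C z r s ->
  Delta_alpha alpha f z = r.
Proof.
  intros Hz Hq Hr. apply (wirtinger_d_z _ _ _ s).
  apply (wirtinger_ext_loc (fun w => weight (- alpha) w * q w)%C); [|exact Hr].
  generalize (open_unit_disk z Hz). apply filter_imp. intros w Hw. now rewrite Hq.
Qed.

Lemma alpha_harmonic_id (alpha : R) : alpha_harmonic alpha (fun z => z).
Proof.
  split.
  - apply (C2_on_of_wirtinger _ open_unit_disk _ (fun _ => 1%C) (fun _ => 0%C)).
    + intros z _. apply wirtinger_id.
    + apply C1_on_const, open_unit_disk.
    + apply C1_on_const, open_unit_disk.
  - intros z Hz.
    apply (Delta_alpha_of_wirtinger _ _ (fun _ => 0%C) _ _ 0%C Hz).
    + intros w _. apply (wirtinger_d_zbar _ _ _ _ (wirtinger_id w)).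
    + apply (wirtinger_ext_loc (fun _ => 0%C)); [|apply wirtinger_const].
      apply filter_forall. intros w. ring.
Qed.

(** A smooth solution of d_zbar f = (1 - |z|^2)^alpha.  Integrating in zbar with z
    fixed gives (1 - (1 - |z|^2)^(alpha + 1)) / ((alpha + 1) z); the integral form
    of the quotient is free of the apparent singularity at 0. *)
Definition test_function (alpha : R) (z : C) : C :=
  (Cconj z * RtoC (moment alpha 0 (Cmod z ^ 2)%R))%C.

(** The derivative in zbar is F(s) + s F'(s) at s = |z|^2, evaluated by
    [moment_identity]. *)
Lemma wirtinger_test_function (alpha : R) (z : C) :
  unit_disk z ->
  wirtinger_at (test_function alpha) z
    (Cconj z * (RtoC (- alpha * moment (alpha - 1) 1 (Cmod z ^ 2)%R)%R * Cconj z))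
    (weight alpha z).
Proof.
  intros Hz. pose proof (Cmod_sqr_lt_1 z Hz) as Hs.
  pose proof (wirtinger_conj _ _ _ _ (wirtinger_id z)) as H1.
  pose proof (wirtinger_radial _ z _ (is_derive_moment alpha 0 _ Hs)) as H2.
  apply (wirtinger_eq _ _ _ _ _ _ (wirtinger_mult _ _ _ _ _ _ _ H1 H2)).
  - apply injective_projections; simpl; ring.
  - unfold weight. rewrite <- (moment_identity alpha _ Hs).
    rewrite RtoC_plus, (RtoC_mult (Cmod z ^ 2)%R), RtoC_Cmod_sqr.
    apply injective_projections; simpl; ring.
Qed.

Lemma alpha_harmonic_test_function (alpha : R) : alpha_harmonic alpha (test_function alpha).
Proof.
  split.
  - apply (C2_on_of_wirtinger _ open_unit_disk _ _ _ (wirtinger_test_function alpha)).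
    + pose proof (C1_on_id _ open_unit_disk) as Hid.
      pose proof (C1_on_conj _ open_unit_disk _ Hid) as Hconj.
      apply C1_on_mult; [apply open_unit_disk|exact Hconj|].
      apply C1_on_mult; [apply open_unit_disk| |exact Hconj].
      apply (C1_on_radial (fun s => - alpha * moment (alpha - 1) 1 s)
        (fun s => - alpha * (- (alpha - 1) * moment (alpha - 1 - 1) 2 s))).
      * intros s Hs. apply is_derive_scal. now apply is_derive_moment.
      * intros s Hs. apply (ex_derive_continuous
          (fun s => - alpha * (- (alpha - 1) * moment (alpha - 1 - 1) 2 s))).
        eexists. apply is_derive_scal, is_derive_scal. now apply is_derive_moment.
    + apply (C1_on_radial (fun s => Rpower (1 - s) alpha)
        (fun s => - alpha * Rpower (1 - s) (alpha - 1))).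
      * intros s Hs. now apply is_derive_Rpower_1m.
      * intros s Hs. apply (ex_derive_continuous (fun s => - alpha * Rpower (1 - s) (alpha - 1))).
        eexists. apply is_derive_scal. now apply is_derive_Rpower_1m.
  - intros z Hz.
    apply (Delta_alpha_of_wirtinger _ _ (weight alpha) _ _ 0%C Hz).
    + intros w Hw. apply (wirtinger_d_zbar _ _ _ _ (wirtinger_test_function alpha w Hw)).
    + apply (wirtinger_ext_loc (fun _ => 1%C)); [|apply wirtinger_const].
      apply filter_forall. intros w. symmetry. apply weight_mult_opp.
Qed.

(** * Consequences for psi of the alpha-harmonicity of the composition *)

(** The function under the operator is
    (1 - |w|^2)^(-alpha) (1 - |psi|^2)^alpha D*.  As D is holomorphic, D* does not
    contribute to the derivative in z, which is the stated equation up to the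
    nonzero factor alpha (1 - |z|^2)^(-alpha) (1 - |psi|^2)^alpha D* divided by
    (1 - |z|^2) (1 - |psi|^2). *)
Lemma conformal_factor_equation (alpha : R) (psi D : C -> C) (z : C) :
  alpha <> 0 ->
  (forall w, unit_disk w -> unit_disk (psi w)) ->
  (forall w, unit_disk w -> wirtinger_at psi w (D w) 0) ->
  (exists l, wirtinger_at D z l 0) ->
  alpha_harmonic alpha (fun w => test_function alpha (psi w)) ->
  unit_disk z -> D z <> 0%C ->
  (Cconj z * (1 - psi z * Cconj (psi z)))%C = (Cconj (psi z) * D z * (1 - z * Cconj z))%C.
Proof.
  intros Halpha Hself Hpsi [l HD] [_ Hharm] Hz HDz.
  assert (Hq : forall w, unit_disk w ->
     d_zbar (fun w => test_function alpha (psi w)) w = (weight alpha (psi w) * Cconj (D w))%C).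
  { intros w Hw. erewrite (wirtinger_d_zbar (fun w => test_function alpha (psi w)));
     [|exact (wirtinger_comp _ _ _ _ _ _ _ (Hpsi w Hw) (wirtinger_test_function alpha _ (Hself w Hw)))].
    ring. }
  pose proof (wirtinger_mult _ _ _ _ _ _ _ (wirtinger_weight (- alpha) z Hz)
     (wirtinger_mult _ _ _ _ _ _ _
        (wirtinger_comp _ _ _ _ _ _ _ (Hpsi z Hz) (wirtinger_weight alpha _ (Hself z Hz)))
        (wirtinger_conj _ _ _ _ HD))) as HG.
  pose proof (Delta_alpha_of_wirtinger _ _ _ _ _ _ Hz Hq HG) as HE.
  rewrite (Hharm z Hz) in HE. clear HG Hq Hharm.
  pose proof (Cmod_sqr_lt_1 z Hz) as Hx. pose proof (Cmod_sqr_lt_1 _ (Hself z Hz)) as Hy.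
  unfold weight in HE.
  rewrite !Rpower_pred in HE by lra.
  set (X := Rpower (1 - Cmod z ^ 2) (- alpha)) in HE.
  set (Y := Rpower (1 - Cmod (psi z) ^ 2) alpha) in HE.
  assert (HX : RtoC X <> 0%C).
  { intros E. apply RtoC_inj in E. unfold X, Rpower in E. pose proof (exp_pos (- alpha * ln (1 - Cmod z ^ 2))). lra. }
  assert (HY : RtoC Y <> 0%C).
  { intros E. apply RtoC_inj in E. unfold Y, Rpower in E. pose proof (exp_pos (alpha * ln (1 - Cmod (psi z) ^ 2))). lra. }
  assert (Ha : RtoC alpha <> 0%C) by (intros E; now apply RtoC_inj in E).
  assert (E0 : Cconj 0 = 0%C) by (apply injective_projections; simpl; ring).
  rewrite E0 in HE.
  rewrite !RtoC_mult, !RtoC_div, !RtoC_opp, !RtoC_1m_Cmod_sqr in HE by lra.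
  pose proof (one_minus_Cmod_sqr_neq_0 z Hz) as H1.
  pose proof (one_minus_Cmod_sqr_neq_0 _ (Hself z Hz)) as H2.
  pose proof (Cconj_neq_0 _ HDz) as H3.

  match type of HE with _ = ?T =>
    assert (HT : (Cconj z * (1 - psi z * Cconj (psi z)) - Cconj (psi z) * D z * (1 - z * Cconj z))%C
      = (T * ((1 - z * Cconj z) * (1 - psi z * Cconj (psi z))) / (RtoC alpha * RtoC X * RtoC Y * Cconj (D z)))%C)
  end.
  { field. repeat split; assumption. }
  rewrite <- HE in HT.
  match type of HT with (?P - ?Q)%C = _ => replace P with (P - Q + Q)%C by ring end.
  rewrite HT. unfold Cdiv. ring.
Qed.

(** Here w and d stand for psi(z) and psi'(z): the first equation is (E), the
    second its derivative in zbar.  By (E), z w* d is real, so the second equation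
    becomes 1 - |w|^2 = |d|^2 (1 - |z|^2).  Inserting this in the squared modulus of
    (E) gives |z|^2 (1 - |w|^2) = |w|^2 (1 - |z|^2), that is |w| = |z|, and then
    |d| = 1. *)
Lemma conformal_factor_rigidity (z w d : C) :
  unit_disk z -> unit_disk w ->
  (Cconj z * (1 - w * Cconj w))%C = (Cconj w * d * (1 - z * Cconj z))%C ->
  (1 - w * Cconj w - Cconj z * (w * Cconj d))%C
    = (d * Cconj d * (1 - z * Cconj z) - Cconj w * d * z)%C ->
  (w * Cconj w)%C = (z * Cconj z)%C /\ (d * Cconj d)%C = 1%C.
Proof.
  intros Hz Hw E B.
  pose proof (one_minus_Cmod_sqr_neq_0 z Hz) as Hx.
  pose proof (one_minus_Cmod_sqr_neq_0 w Hw) as Hy.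
  assert (E' : (z * (1 - w * Cconj w))%C = (w * Cconj d * (1 - z * Cconj z))%C).
  { assert (E1 : Cconj 1 = 1%C) by (apply injective_projections; simpl; ring).
    apply (f_equal Cconj) in E.
    rewrite !Cmult_conj, !Cminus_conj, !Cmult_conj, !Cconj_conj, E1 in E.
    rewrite (Cmult_comm w (Cconj w)), (Cmult_comm z (Cconj z)). exact E. }
  assert (cancel : forall a b c : C, c <> 0%C -> (a * c)%C = (b * c)%C -> a = b).
  { intros a b c Hc H.
    transitivity (a * c / c)%C; [field; exact Hc|]. rewrite H. field. exact Hc. }
  (* Both sides, times 1 - |z|^2, are |z|^2 (1 - |w|^2). *)
  assert (S : (z * (Cconj w * d))%C = (Cconj z * (w * Cconj d))%C).
  { apply (cancel _ _ _ Hx).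
    transitivity (z * (Cconj w * d * (1 - z * Cconj z)))%C; [ring|]. rewrite <- E.
    transitivity (Cconj z * (z * (1 - w * Cconj w)))%C; [ring|]. rewrite E'. ring. }
  assert (M : (1 - w * Cconj w)%C = (d * Cconj d * (1 - z * Cconj z))%C).
  { transitivity (1 - w * Cconj w - Cconj z * (w * Cconj d) + Cconj z * (w * Cconj d))%C; [ring|].
    rewrite B, <- S. ring. }
  assert (P : (z * Cconj z * (1 - w * Cconj w))%C = (w * Cconj w * (1 - z * Cconj z))%C).
  { apply (cancel _ _ _ Hy).
    transitivity ((z * (1 - w * Cconj w)) * (Cconj z * (1 - w * Cconj w)))%C; [ring|].
    rewrite E, E'.
    transitivity (w * Cconj w * (d * Cconj d * (1 - z * Cconj z)) * (1 - z * Cconj z))%C; [ring|].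
    rewrite <- M. ring. }
  assert (Q : (w * Cconj w)%C = (z * Cconj z)%C).
  { transitivity (w * Cconj w * (1 - z * Cconj z) + z * Cconj z * (w * Cconj w))%C; [ring|].
    rewrite <- P. ring. }
  split; [exact Q|].
  apply (cancel _ _ _ Hx). rewrite <- M, Q. ring.
Qed.

(** As D is continuous, (E) holds in a whole neighbourhood of z and may be
    differentiated in zbar. *)
Lemma derivative_unimodular (psi D : C -> C) :
  (forall w, unit_disk w -> unit_disk (psi w)) ->
  (forall w, unit_disk w -> wirtinger_at psi w (D w) 0) ->
  (forall w, unit_disk w -> exists l, wirtinger_at D w l 0) ->
  (forall w, unit_disk w -> D w <> 0%C ->
    (Cconj w * (1 - psi w * Cconj (psi w)))%C = (Cconj (psi w) * D w * (1 - w * Cconj w))%C) ->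
  forall z, unit_disk z -> D z <> 0%C ->
  (psi z * Cconj (psi z))%C = (z * Cconj z)%C /\ (D z * Cconj (D z))%C = 1%C.
Proof.
  intros Hself Hpsi HD HE z Hz HDz.
  apply conformal_factor_rigidity; auto.
  destruct (HD z Hz) as [l Hl].
  pose proof (wirtinger_conj _ _ _ _ (wirtinger_id z)) as Hzb.
  pose proof (wirtinger_conj _ _ _ _ (Hpsi z Hz)) as Hpb.
  (* The derivatives of 1 - |f|^2, needed for f = psi and f = id. *)
  assert (Hdefect : forall f p q, wirtinger_at f z p q ->
     wirtinger_at (fun w => 1 + (-(1)) * (f w * Cconj (f w)))%C z
       (0 + (0 * (f z * Cconj (f z)) + (-(1)) * (p * Cconj (f z) + f z * Cconj q)))
       (0 + (0 * (f z * Cconj (f z)) + (-(1)) * (q * Cconj (f z) + f z * Cconj p)))).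
  { intros f p q Hf. apply (wirtinger_plus (fun _ => 1%C)); [apply wirtinger_const|].
    apply (wirtinger_mult (fun _ => (-(1))%C) (fun w => f w * Cconj (f w))%C);
      [apply wirtinger_const|].
    apply (wirtinger_mult f (fun w => Cconj (f w))); [exact Hf|now apply wirtinger_conj]. }
  pose proof (wirtinger_mult _ _ _ _ _ _ _ Hzb (Hdefect _ _ _ (Hpsi z Hz))) as HL.
  pose proof (wirtinger_mult _ _ _ _ _ _ _ (wirtinger_mult _ _ _ _ _ _ _ Hpb Hl)
     (Hdefect _ _ _ (wirtinger_id z))) as HR.
  assert (Hloc : locally (T := C_UniformSpace) z (fun w =>
     (Cconj w * (1 + (-(1)) * (psi w * Cconj (psi w))))%C
     = (Cconj (psi w) * D w * (1 + (-(1)) * (w * Cconj w)))%C)).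
  { assert (Hnz : locally (T := C_UniformSpace) z (fun w => D w <> 0%C)).
    { pose proof (continuous_Cmod _ _ _ (wirtinger_continuous _ _ _ _ Hl)) as Hc.
      apply Cmod_gt_0 in HDz.
      generalize (Hc _ (open_gt 0 _ HDz)). unfold filtermap. apply filter_imp.
      intros w Hw. apply Cmod_gt_0. exact Hw. }
    generalize (filter_and _ _ (open_unit_disk z Hz) Hnz). apply filter_imp.
    intros w [Hw HDw]. pose proof (HE w Hw HDw) as HEw.
    transitivity (Cconj w * (1 - psi w * Cconj (psi w)))%C; [ring|]. rewrite HEw. ring. }
  apply (wirtinger_ext_loc _ _ _ _ _ Hloc) in HL.
  pose proof (eq_trans (eq_sym (wirtinger_d_zbar _ _ _ _ HL)) (wirtinger_d_zbar _ _ _ _ HR)) as Q1.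
  cbv beta in Q1.
  assert (E1 : Cconj 1 = 1%C) by (apply injective_projections; simpl; ring).
  rewrite E1 in Q1.
  match type of Q1 with ?A = ?B =>
    transitivity A; [ring|rewrite Q1; ring] end.
Qed.

(** Along the segment from a zero of D to [z0], the modulus of D would take the
    value 1/2. *)
Lemma derivative_nowhere_zero (D : C -> C) :
  (forall w, unit_disk w -> continuous D w) ->
  (forall w, unit_disk w -> D w <> 0%C -> (D w * Cconj (D w))%C = 1%C) ->
  forall z0 z, unit_disk z0 -> unit_disk z -> D z0 <> 0%C -> D z <> 0%C.
Proof.
  intros Hc H1 z0 z Hz0 Hz HD0 HDz.
  assert (Hseg : forall t, 0 <= t <= 1 -> unit_disk (z + RtoC t * (z0 - z))).
  { intros t Ht. unfold unit_disk in *.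
    replace (z + RtoC t * (z0 - z))%C with (RtoC (1 - t) * z + RtoC t * z0)%C
      by (rewrite RtoC_minus; ring).
    eapply Rle_lt_trans; [apply Cmod_triangle|].
    rewrite !Cmod_mult, !Cmod_R, !Rabs_pos_eq by lra.
    destruct (Req_dec t 0) as [->|Ht0]; [lra|].
    assert (t * Cmod z0 < t) by nra. assert ((1 - t) * Cmod z <= 1 - t) by nra. lra. }
  assert (Hsq : forall w, unit_disk w -> D w <> 0%C -> Cmod (D w) = 1).
  { intros w Hw HDw. pose proof (H1 w Hw HDw) as E. rewrite <- RtoC_Cmod_sqr in E.
    apply RtoC_inj in E. pose proof (Cmod_ge_0 (D w)). nra. }
  destruct (Ranalysis5.IVT_interv (fun t => Cmod (D (z + RtoC t * (z0 - z))%C) - / 2) 0 1)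
    as (t & Ht & E).
  - intros t Ht. apply continuity_pt_filterlim.
    apply (continuous_minus (V := R_NormedModule)
      (fun t => Cmod (D (z + RtoC t * (z0 - z))%C)) (fun _ => / 2)); [|apply continuous_const].
    apply continuous_Cmod, continuous_comp; [apply continuous_line|]. now apply Hc, Hseg.
  - lra.
  - replace (z + RtoC 0 * (z0 - z))%C with z by ring. rewrite HDz, Cmod_0. lra.
  - replace (z + RtoC 1 * (z0 - z))%C with z0 by ring. rewrite Hsq by assumption. lra.
  - destruct (Ceq_dec (D (z + RtoC t * (z0 - z))%C) 0) as [E'|E'].
    + rewrite E', Cmod_0 in E. lra.
    + rewrite (Hsq _ (Hseg t Ht) E') in E. lra.
Qed.

Lemma composition_forces_rotation (alpha : R) (psi : C -> C) :
  alpha <> 0 ->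
  analytic_on unit_disk psi ->
  (forall z, unit_disk z -> unit_disk (psi z)) ->
  ~ constant_on unit_disk psi ->
  C2_on unit_disk psi ->
  alpha_harmonic alpha (fun z => test_function alpha (psi z)) ->
  exists a, Cmod a ^ 2 = 1 /\ forall z, unit_disk z -> psi z = (a * z)%C.
Proof.
  intros Halpha Hana Hself Hconst H2 Htest.
  assert (Hpsi : forall z, unit_disk z -> wirtinger_at psi z (dx psi z) 0).
  { intros z Hz. destruct (Hana z Hz) as [l Hl]. apply wirtinger_holomorphic in Hl.
    apply (wirtinger_eq _ _ _ _ _ _ Hl); [|reflexivity].
    rewrite (proj2 (wirtinger_dx _ _ _ _ Hl)). symmetry. apply Cplus_0_r. }
  set (D := dx psi) in *.
  pose proof (holomorphic_derivative _ open_unit_disk psi Hpsi H2) as HD. fold D in HD.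
  assert (HDc : forall z, unit_disk z -> continuous D z).
  { intros z Hz. exact (wirtinger_continuous _ _ _ _ (HD z Hz)). }
  assert (H0 : forall z, unit_disk z -> forall t, 0 <= t <= 1 -> unit_disk (RtoC t * z)).
  { intros z Hz t Ht. now apply unit_disk_scale. }
  assert (Huni : forall z, unit_disk z -> D z <> 0%C ->
    (psi z * Cconj (psi z))%C = (z * Cconj z)%C /\ (D z * Cconj (D z))%C = 1%C).
  { apply derivative_unimodular; auto.
    - intros w Hw. eexists. now apply HD.
    - intros w Hw HDw. apply (conformal_factor_equation alpha psi D); auto.
      eexists. now apply HD. }
  assert (Hz0 : exists z0, unit_disk z0 /\ D z0 <> 0%C).
  { apply NNPP. intros N. apply Hconst. exists (psi 0%C). intros z Hz.
    apply constant_on_ray.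
    - intros t Ht. exists 0%C, 0%C. split; [|ring].
      assert (Htz : unit_disk (RtoC t * z)) by (apply H0; [exact Hz|lra]).
      apply (wirtinger_eq _ _ _ _ _ _ (Hpsi _ Htz)); [|reflexivity].
      apply NNPP. intros E. apply N. eexists. split; eassumption.
    - intros t Ht. exact (wirtinger_continuous _ _ _ _ (Hpsi _ (H0 z Hz t Ht))). }
  destruct Hz0 as (z0 & Hz0 & HDz0).
  assert (HDnz : forall z, unit_disk z -> D z <> 0%C).
  { intros z Hz. apply (derivative_nowhere_zero D HDc) with z0; auto.
    intros w Hw HDw. now apply Huni. }
  assert (Hlin : forall z, unit_disk z -> psi z = (z * D z)%C).
  { intros z Hz. destruct (Huni z Hz (HDnz z Hz)) as [M1 M2].
    pose proof (conformal_factor_equation alpha psi D z Halpha Hself Hpsi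
      (ex_intro (fun l => wirtinger_at D z l 0) _ (HD z Hz)) Htest Hz (HDnz z Hz)) as E.
    rewrite M1 in E.
    pose proof (one_minus_Cmod_sqr_neq_0 z Hz) as Hx.
    assert (E2 : Cconj z = (Cconj (psi z) * D z)%C).
    { transitivity (Cconj z * (1 - z * Cconj z) / (1 - z * Cconj z))%C; [field; exact Hx|].
      rewrite E. field. exact Hx. }
    apply (f_equal Cconj) in E2. rewrite Cmult_conj, !Cconj_conj in E2.
    transitivity (psi z * Cconj (D z) * D z)%C; [|now rewrite <- E2].
    transitivity (psi z * (D z * Cconj (D z)))%C; [rewrite M2; ring|ring]. }
  (* The derivative in z of psi = z D is D itself. *)
  assert (HDD : forall z, unit_disk z -> (z * dx D z)%C = 0%C).
  { intros z Hz.
    pose proof (wirtinger_mult _ _ _ _ _ _ _ (wirtinger_id z) (HD z Hz)) as HM.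
    apply (wirtinger_ext_loc _ psi) in HM.
    - pose proof (wirtinger_d_z _ _ _ _ HM) as E.
      rewrite (wirtinger_d_z _ _ _ _ (Hpsi z Hz)) in E.
      transitivity (1 * D z + z * dx D z - D z)%C; [ring|]. rewrite <- E. ring.
    - generalize (open_unit_disk z Hz). apply filter_imp. intros w Hw. symmetry. now apply Hlin. }
  assert (HDconst : forall z, unit_disk z -> D z = D 0%C).
  { intros z Hz. apply constant_on_ray.
    - intros t Ht. assert (Htz : unit_disk (RtoC t * z)) by (apply H0; [exact Hz|lra]).
      exists (dx D (RtoC t * z)), 0%C. split; [now apply HD|].
      assert (Ht0 : RtoC t <> 0%C) by (intros E; apply RtoC_inj in E; lra).
      transitivity (RtoC t * z * dx D (RtoC t * z) / RtoC t)%C; [field; exact Ht0|].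
      rewrite (HDD _ Htz). unfold Cdiv. ring.
    - intros t Ht. apply HDc, H0; assumption. }
  exists (D 0%C).
  assert (Z : unit_disk 0) by (unfold unit_disk; rewrite Cmod_0; lra).
  split.
  - apply RtoC_inj. rewrite RtoC_Cmod_sqr. now apply Huni, HDnz.
  - intros z Hz. rewrite (Hlin z Hz), (HDconst z Hz). ring.
Qed.

(** * Rotations *)

Lemma rotation_preserves (alpha : R) (psi f : C -> C) (a : C) :
  Cmod a = 1 -> (forall z, unit_disk z -> psi z = (a * z)%C) ->
  alpha_harmonic alpha f -> alpha_harmonic alpha (fun z => f (psi z)).
Proof.
  intros Ha Hpsi [H2 HD].
  assert (Hdisk : forall z, unit_disk z -> unit_disk (a * z)).
  { unfold unit_disk. intros z Hz. rewrite Cmod_mult, Ha. lra. }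
  assert (Hrot : forall z, wirtinger_at (fun w => a * w)%C z a 0).
  { intros z. apply (wirtinger_eq _ _ _ _ _ _
      (wirtinger_mult _ _ _ _ _ _ _ (wirtinger_const a z) (wirtinger_id z))); ring. }
  assert (Hrot1 : C1_on unit_disk (fun z => a * z)%C).
  { apply C1_on_mult; [apply open_unit_disk|apply C1_on_const, open_unit_disk|
      apply C1_on_id, open_unit_disk]. }
  assert (Hw : forall z, unit_disk z -> wirtinger_at (fun w => f (psi w)) z
     (a * d_z f (a * z)) (Cconj a * d_zbar f (a * z))).
  { intros z Hz. apply (wirtinger_ext_loc (fun w => f (a * w)%C)).
    - generalize (open_unit_disk z Hz). apply filter_imp. intros w Hw. now rewrite Hpsi.
    - apply (wirtinger_eq _ _ _ _ _ _ (wirtinger_comp _ _ _ _ _ _ _ (Hrot z)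
        (C1_on_wirtinger _ _ _ open_unit_disk (proj1 H2) (Hdisk z Hz)))).
      + apply injective_projections; simpl; ring.
      + ring. }
  split.
  - apply (C2_on_of_wirtinger _ open_unit_disk _ _ _ Hw).
    + apply C1_on_mult; [apply open_unit_disk|apply C1_on_const, open_unit_disk|].
      apply (C1_on_comp _ open_unit_disk unit_disk); auto using open_unit_disk.
      apply C2_on_d_z; auto using open_unit_disk.
    + apply C1_on_mult; [apply open_unit_disk|apply C1_on_const, open_unit_disk|].
      apply (C1_on_comp _ open_unit_disk unit_disk); auto using open_unit_disk.
      apply C2_on_d_zbar; auto using open_unit_disk.
  - intros z Hz.
    assert (HG : exists p q, wirtinger_at (fun w => weight (- alpha) w * d_zbar f w)%C (a * z) p q).
    { do 2 eexists. apply wirtinger_mult.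
      - now apply wirtinger_weight, Hdisk.
      - apply (C1_on_wirtinger unit_disk); auto using open_unit_disk.
        apply C2_on_d_zbar; auto using open_unit_disk. }
    destruct HG as (p & q & HG).
    assert (Hp : p = 0%C).
    { rewrite <- (HD _ (Hdisk z Hz)). symmetry.
      exact (Delta_alpha_of_wirtinger _ _ _ _ _ _ (Hdisk z Hz) (fun w _ => eq_refl) HG). }
    subst p.
    apply (Delta_alpha_of_wirtinger _ _ (fun w => Cconj a * d_zbar f (a * w))%C _ _
       (Cconj a * (q * Cconj a))%C Hz).
    + intros w Hw'. apply (wirtinger_d_zbar _ _ _ _ (Hw w Hw')).
    + apply (wirtinger_ext_loc (fun w => Cconj a * (weight (- alpha) (a * w) * d_zbar f (a * w)))%C).
      * apply filter_forall. intros w.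
        assert (E : weight (- alpha) (a * w) = weight (- alpha) w).
        { unfold weight. now rewrite Cmod_mult, Ha, Rmult_1_l. }
        rewrite E. ring.
      * apply (wirtinger_eq _ _ _ _ _ _ (wirtinger_mult _ _ _ _ _ _ _ (wirtinger_const (Cconj a) z)
          (wirtinger_comp _ _ _ _ _ _ _ (Hrot z) HG))).
        -- apply injective_projections; simpl; ring.
        -- ring.
Qed.

Lemma cis_exists (a : C) : Cmod a ^ 2 = 1 -> exists t, 0 <= t <= 2 * PI /\ a = cis t.
Proof.
  rewrite Cmod2_alt. destruct a as [x y]. simpl. intros H.
  assert (Hx : -1 <= x <= 1) by nra.
  pose proof (acos_bound x) as Hb. pose proof (cos_acos x Hx) as Hc.
  pose proof (sin_acos x Hx) as Hs.
  assert (Hy : sqrt (1 - Rsqr x) = Rabs y).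
  { rewrite <- sqrt_Rsqr_abs. f_equal. unfold Rsqr. lra. }
  rewrite Hy in Hs. destruct (Rle_lt_dec 0 y) as [Hp|Hn].
  - exists (acos x). split; [lra|]. unfold cis. rewrite Hc, Hs, Rabs_pos_eq; auto.
  - exists (2 * PI - acos x). split; [lra|]. unfold cis.
    rewrite cos_minus, sin_minus, cos_2PI, sin_2PI, Hc, Hs, Rabs_left by exact Hn.
    f_equal; ring.
Qed.

Lemma Cmod_cis (t : R) : Cmod (cis t) = 1.
Proof.
  pose proof (sin2_cos2 t) as H. unfold Rsqr in H.
  unfold cis, Cmod. simpl.
  match goal with |- sqrt ?x = 1 => replace x with 1 by lra end. apply sqrt_1.
Qed.

Theorem theorem2p3 (alpha : R)
  (Halpha : (-1 < alpha < 0) \/ 0 < alpha)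
  (psi : C -> C)
  (Hanalytic : analytic_on unit_disk psi)
  (Hself : forall z : C, unit_disk z -> unit_disk (psi z))
  (Hnonconst : ~ constant_on unit_disk psi) :
  (forall f : C -> C,
     alpha_harmonic alpha f -> alpha_harmonic alpha (fun z : C => f (psi z)))
  <->
  (exists t : R, 0 <= t <= 2 * PI /\
     forall z : C, unit_disk z -> psi z = (cis t * z)%C).
Proof.
  split.
  - intros H.
    destruct (composition_forces_rotation alpha psi) as (a & Ha & Hrot); auto.
    + lra.
    + exact (proj1 (H _ (alpha_harmonic_id alpha))).
    + exact (H _ (alpha_harmonic_test_function alpha)).
    + destruct (cis_exists a Ha) as (t & Ht & ->). now exists t.
  - intros (t & _ & Hrot) f Hf.
    now apply (rotation_preserves alpha psi f (cis t) (Cmod_cis t)).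
Qed.
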